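(* Let $X$ be a connected finite quandle and $\phi\in Z^3_{\mathrm Q}(X;A)$ a quandle $3$-cocycle of $X$. For any link $L$, the equation $$\Phi_\phi(L)=|X|\cdot\Phi^\ast_\phi(L)$$ holds between the shadow cocycle invariant $\Phi_\phi(L)$ and the based shadow cocycle invariant $\Phi_\phi^\ast(L)$.
   Context: A quandle is a non-empty set $X$ with binary operations $\lhd,\blacktriangleleft$ (also written $\lhd^{+1},\lhd^{-1}$) such that $(a\lhd b)\blacktriangleleft b=a=(a\blacktriangleleft b)\lhd b$, $(a\lhd b)\lhd c=(a\lhd c)\lhd(b\lhd c)$ and $a\lhd a=a=a\blacktriangleleft a$. It is connected if for all $a,b\in X$ there are finite sequences $x_i\in X$, $\epsilon_i\in\{\pm1\}$ with $(\cdots(a\lhd^{\epsilon_1}x_1)\cdots)\lhd^{\epsilon_n}x_n=b$. Let $A$ be a ring with unit; its additive group is written multiplicatively below. A quandle 3-cocycle $\phi\in Z^3_{\mathrm Q}(X;A)$ is a map $\phi:X^3\to A$ with $\phi(x,x,y)=\phi(x,y,y)=1$ for all $x,y$ (here $1$ is the neutral element of the multiplicatively written additive group), whose (multi-)linear extension to $\mathbb{Z}[X^3]$ vanishes (i.e. is the neutral element) on the image of $\partial_4$, where $\partial_n(x_1,\dots,x_n)=\sum_{i=1}^n(-1)^{n-i}\{(x_1\lhd x_i,\dots,x_{i-1}\lhd x_i,x_{i+1},\dots,x_n)-(x_1,\dots,x_{i-1},x_{i+1},\dots,x_n)\}$. Link diagrams: a diagram $D$ of an oriented link $L$ lies on the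 oriented sphere $\mathbb{S}^2$. Arcs are the components of $D$ after cutting the lower strand at each crossing; regions are the components of $\mathbb{S}^2\setminus D$. Every arc has a normal vector pointing to the left of its orientation. For a non-crossing point $p$ on an arc $c_p$, $r_p^{\mathrm{ini}}$ and $r_p^{\mathrm{ter}}$ are the adjacent regions, the normal vector pointing from $r_p^{\mathrm{ini}}$ to $r_p^{\mathrm{ter}}$. At a crossing $c$, $o_c$ is the over-arc and $u_c^{\mathrm{ini}},u_c^{\mathrm{ter}}$ are the under-arcs, the normal of $o_c$ pointing to the side of $u_c^{\mathrm{ter}}$; $r_c^{\mathrm{ini}}$ is the region adjacent to $c$ that is the initial region of all the arcs adjacent to both $c$ and that region; $\epsilon_c=\pm1$ is the usual sign of the crossing. An $X$-shadow colouring $C$ of $D$ assigns elements of $X$ to the arcs and to the regions so that $C(u_c^{\mathrm{ini}})\lhd C(o_c)=C(u_c^{\mathrm{ter}})$ at each crossing $c$, and $C(r_p^{\mathrm{ini}})\lhd C(c_p)=C(r_p^{\mathrm{ter}})$ at each non-crossing point $p\in D$. The Boltzmann weight of a crossing is $w(c)=\phi(C(r_c^{\mathrm{ini}}),C(u_c^{\mathrm{ini}}),C(o_c))^{\epsilon_c}\in A$, and the whole weight is $W(C)=\prod_c w(c)$ over all crossings. The shadow cocycle invariant is $\Phi_\phi(L)=\sum_C W(C)\in\mathbb{Z}[A]$ (the group ring of the multiplicatively written group), summed over all $X$-shadow colourings $C$ of $D$. For the based shadow cocycle invariant, fix a chosen non-crossing point $p$ on an arc of $D$; $\Phi_\phi^\ast(L)=\sum_C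 W(C)\in\mathbb{Z}[A]$, summed only over those $X$-shadow colourings $C$ for which both $r_p^{\mathrm{ini}}$ and $r_p^{\mathrm{ter}}$ have the same colour as $c_p$. Both are known to be invariants of $L$ and may be computed from any diagram $D$ of $L$ (and any chosen point $p$). *)

(* Defs.v *)
From HB Require Import structures.
From mathcomp Require Import all_boot all_order all_algebra.
From mathcomp Require Import finmap monalg.

Set Implicit Arguments.
Unset Strict Implicit.
Unset Printing Implicit Defensive.

Import GRing.Theory.
Local Open Scope ring_scope.

Reserved Notation "a ◁ b" (at level 40, left associativity).
Reserved Notation "a ◀ b" (at level 40, left associativity).

HB.mixin Record isQuandle X of Choice X := {
  qop : X -> X -> X;
  qinv : X -> X -> X;
  quandle_inhabited : inhabited X;
  qopK : forall a b : X, qinv (qop a b) b = a;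
  qinvK : forall a b : X, qop (qinv a b) b = a;
  qop_distr : forall a b c : X,
    qop (qop a b) c = qop (qop a c) (qop b c);
  qop_idem : forall a : X, qop a a = a;
  qinv_idem : forall a : X, qinv a a = a
}.

#[short(type="quandleType")]
HB.structure Definition Quandle := {X of isQuandle X & Choice X}.

#[short(type="finQuandleType")]
HB.structure Definition FinQuandle := {X of Quandle X & Finite X}.

Notation "a ◁ b" := (qop a b) : ring_scope.
Notation "a ◀ b" := (qinv a b) : ring_scope.

(* a ◁^ε b, with ε = +1 encoded as true and ε = -1 as false *)
Definition qexp (X : quandleType) (a : X) (e : bool) (b : X) : X :=
  if e then a ◁ b else a ◀ b.

Definition quandle_connected (X : quandleType) : Prop :=
  forall a b : X, exists s : seq (bool * X),
    foldl (fun y ex => qexp y ex.1 ex.2) a s = b.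

(* {malg int[K]} is the free abelian group Z[K] on K. *)
Definition linear_ext (K : choiceType) (V : zmodType) (f : K -> V)
    (c : {malg int[K]}) : V :=
  \sum_(x <- msupp c) f x *~ c@_x.

Section Cocycle.
Variable X : quandleType.

(* Indices are counted from 0, so that x = (x_0, ..., x_n) lies in X^(n+1):
   face i x omits x_i, and face_act i x moreover acts by x_i on x_0..x_(i-1). *)
Definition face n (i : 'I_n.+1) (x : n.+1.-tuple X) : n.-tuple X :=
  [tuple tnth x (lift i j) | j < n].

Definition face_act n (i : 'I_n.+1) (x : n.+1.-tuple X) : n.-tuple X :=
  [tuple (if (lift i j < i)%N then tnth x (lift i j) ◁ tnth x i
          else tnth x (lift i j)) | j < n].

(* boundary n is the map usually indexed by n + 1, Z[X^(n+1)] -> Z[X^n];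
   the sign of the 0-based index i is (-1)^((n+1)-(i+1)). *)
Definition boundary n : {malg int[n.+1.-tuple X]} -> {malg int[n.-tuple X]} :=
  linear_ext (fun x =>
    \sum_(i < n.+1) (-1) ^+ (n - i) *: (<< face_act i x >> - << face i x >>)).

(* Only the additive group of A matters; it is written additively. *)
Definition quandle_3cocycle (A : pzRingType) (phi : 3.-tuple X -> A) : Prop :=
  [/\ forall x y : X, phi [tuple x; x; y] = 0,
      forall x y : X, phi [tuple x; y; y] = 0
    & forall c : {malg int[4.-tuple X]}, linear_ext phi (boundary c) = 0].

End Cocycle.

(* Oriented link diagrams on the oriented sphere, up to isotopy.  An edge is a
   component of the diagram minus its crossings: either an open segment, which
   leaves one crossing and arrives at one crossing, or a closed crossing-free
   component.  The regions of a disconnected diagram are not determined by the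
   edges and crossings alone, so they are part of the data, together with the
   regions lying to the left and to the right of each edge. *)
Record diagram_data := DiagramData {
  crossing : finType;
  edge : finType;
  region : finType;
  positive : crossing -> bool;
  over_in : crossing -> edge;
  over_out : crossing -> edge;
  under_in : crossing -> edge;
  under_out : crossing -> edge;
  left_region : edge -> region;
  right_region : edge -> region
}.

Section DiagramData.
Variable D : diagram_data.

Definition incoming (p : crossing D * bool) : edge D :=
  if p.2 then over_in p.1 else under_in p.1.

Definition outgoing (p : crossing D * bool) : edge D :=
  if p.2 then over_out p.1 else under_out p.1.

Definition open_edge : pred (edge D) := [pred e | e \in codom outgoing].

Definition strands_wf : Prop :=
  [/\ injective incoming, injective outgoing & codom incoming =i codom outgoing].

(* Normal vectors point to the left, and the normal vector of the over-arc
   points to the side of u_c^ter.  Seen from the over-strand, the under-strand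
   of a positive crossing runs from right to left, that of a negative crossing
   from left to right. *)
Definition under_ini (c : crossing D) : edge D :=
  if positive c then under_in c else under_out c.

Definition under_ter (c : crossing D) : edge D :=
  if positive c then under_out c else under_in c.

(* A side of an edge: (e, true) is the left side, (e, false) the right one. *)
Definition side : finType := (edge D * bool)%type.

Definition side_region (s : side) : region D :=
  if s.2 then left_region s.1 else right_region s.1.

(* The four corners at c, seen from the over-strand: ahead (h) or behind, and
   on the left (l) or on the right.  Each is bounded by one side of an edge of
   the over-strand and one side of an edge of the under-strand: the side of the
   under-strand lying ahead is its right side iff c is positive. *)
Definition corner_over (c : crossing D) (h l : bool) : side :=
  (if h then over_out c else over_in c, l).

Definition corner_under (c : crossing D) (h l : bool) : side :=
  (if l then under_ter c else under_ini c, h (+) positive c).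

Definition corners_wf : Prop := forall (c : crossing D) (h l : bool),
  side_region (corner_over c h l) = side_region (corner_under c h l).

(* Two sides are linked when they meet at a corner.  The connected components
   of this symmetric relation are the boundary circles of the regions. *)
Definition side_link : rel side := fun s t =>
  [exists c : crossing D, [exists h : bool, [exists l : bool,
    ((s, t) == (corner_over c h l, corner_under c h l)) ||
    ((t, s) == (corner_over c h l, corner_under c h l))]]].

Definition boundary_circles (r : region D) : nat :=
  n_comp side_link [pred s | side_region s == r].

Definition region_link : rel (region D) := fun r s =>
  [exists e : edge D, ((r, s) == (right_region e, left_region e)) ||
                      ((s, r) == (right_region e, left_region e))].

(* The surface obtained by glueing to the diagram, for each region r, a sphere
   with boundary_circles r holes is a sphere: it is connected and has Euler
   characteristic 2.  Closed edges are circles and contribute 0. *)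
Definition spherical : Prop :=
  (forall r s : region D, connect region_link r s) /\
  #|crossing D|%:Z - #|open_edge|%:Z
    + \sum_(r : region D) (2 - (boundary_circles r)%:Z) = 2.

End DiagramData.

Record diagram := Diagram {
  diagram_of :> diagram_data;
  diagram_strands : strands_wf diagram_of;
  diagram_corners : corners_wf diagram_of;
  diagram_spherical : spherical diagram_of
}.

Section Colouring.
Variable D : diagram.

Definition strand_link : rel (edge D) := fun e f =>
  [exists c : crossing D, ((e, f) == (over_in c, over_out c)) ||
                          ((f, e) == (over_in c, over_out c))].

Definition strand (e : edge D) : {set edge D} :=
  [set f | connect strand_link e f].

(* Arcs are the components of D cut at the lower strand of each crossing. *)
Definition arc : finType := {a : {set edge D} | a \in [set strand e | e : edge D]}.

Lemma strand_is_arc (e : edge D) : strand e \in [set strand e | e : edge D].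
Proof. exact: imset_f. Qed.

Definition arc_of (e : edge D) : arc := exist _ (strand e) (strand_is_arc e).

Definition o_arc (c : crossing D) : arc := arc_of (over_out c).
Definition u_ini (c : crossing D) : arc := arc_of (under_ini c).
Definition u_ter (c : crossing D) : arc := arc_of (under_ter c).

(* The corner both of whose sides are right sides. *)
Definition r_ini (c : crossing D) : region D :=
  side_region (corner_over c (positive c) false).

Variable X : finQuandleType.

Definition colouring : finType := ({ffun arc -> X} * {ffun region D -> X})%type.

Definition shadow_colouring (C : colouring) : bool :=
  [forall c : crossing D, C.1 (u_ini c) ◁ C.1 (o_arc c) == C.1 (u_ter c)] &&
  [forall e : edge D,
    C.2 (right_region e) ◁ C.1 (arc_of e) == C.2 (left_region e)].

(* A non-crossing point is given by the edge p on which it lies; its initial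
   and terminal regions are those to the right and to the left of p. *)
Definition based_at (p : edge D) (C : colouring) : bool :=
  (C.2 (right_region p) == C.1 (arc_of p)) &&
  (C.2 (left_region p) == C.1 (arc_of p)).

Variables (A : pzRingType) (phi : 3.-tuple X -> A).

Definition boltzmann_weight (C : colouring) (c : crossing D) : A :=
  let w := phi [tuple C.2 (r_ini c); C.1 (u_ini c); C.1 (o_arc c)] in
  if positive c then w else - w.

Definition whole_weight (C : colouring) : A :=
  \sum_(c : crossing D) boltzmann_weight C c.

(* Values in the group ring Z[A] of the additive group of A, of which only the
   additive structure is used. *)
Definition shadow_invariant : {malg int[A]} :=
  \sum_(C : colouring | shadow_colouring C) << whole_weight C >>.

Definition based_shadow_invariant (p : edge D) : {malg int[A]} :=
  \sum_(C : colouring | shadow_colouring C && based_at p C) << whole_weight C >>.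

End Colouring.

(* Main.v *)
From HB Require Import structures.
Require Import Defs.
From mathcomp Require Import all_boot all_order all_algebra all_fingroup.
From mathcomp Require Import finmap monalg.
From mathcomp Require Import ring lra zify.

Set Implicit Arguments.
Unset Strict Implicit.
Unset Printing Implicit Defensive.

Import GRing.Theory Num.Theory.
Local Open Scope ring_scope.

(** Fix a colouring [k] of the arcs that obeys the crossings.  On the sphere, the
colour of one region can be prescribed at will and then determines the colours
of all the others.
So, among the #|X| shadow colourings that extend [k], exactly one is based at
[p], and the theorem follows if all of them have the same weight.

Equality of the weights ([whole_weight_base]).  Two extensions [s] and [x] of
[k] can be multiplied pointwise, and [s ◁ x] is again an extension.  Pictorially
a small circle in a region is pulled under the whole diagram until it surrounds
everything; the regions that it sweeps go from [s r] to [s r ◁ x r], and [x r]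
is the colour of the moving circle while it lies in [r].  Its invariance is the
cocycle condition at (s r, x r, colour of the under-arc, colour of the
over-arc), which writes the change of the weight at a crossing as a sum over
the incoming edges minus a sum over the outgoing edges of one function of the
edges.  These sums cancel over the whole diagram ([whole_weight_act]).  Since
X is connected, such moves reach every colour of a given region.

Existence of extensions ([region_colouring_exists]).  Crossing an edge acts on
the colours of the regions by a permutation of X, and at every crossing these
permutations commute around the four corners.  A labelling of the edges by
elements of a group with that property comes from a labelling of the regions
([flat_labelling_potential]), as the sphere is simply connected.  With the
sphere given by its Euler characteristic, this is proved in two stages.
- Over the rationals, a flow on the 4-valent graph is a difference of values on
  the two sides of the edges ([flow_exact]): otherwise some linear system whose
  size is given by the Euler characteristic would be both injective and have
  more unknowns than equations.
- For a group G, relabel the regions so that as many edges as possible become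
  trivial.  Then the trivial edges already connect all the regions, and no
  crossing meets the nontrivial edges exactly once.  If there were nontrivial
  edges, they would carry a nonzero flow ([flow_supported]); this flow is the
  difference of a function that is constant on the regions, hence zero. *)

(** * Counting in linear algebra and groups *)

Lemma linear_system_solution (F : fieldType) (I J : finType)
    (f : J -> {ffun I -> F^o} -> F^o) :
  (forall j, linear (f j)) -> (#|J| < #|I|)%N ->
  exists2 x, forall j, f j x = 0 & x != 0.
Proof.
move=> f_lin ltJI.
pose g x : {ffun J -> F^o} := [ffun j => f j x].
have g_lin : linear g by move=> a x y; apply/ffunP => j; rewrite !ffunE f_lin.
pose gL : {linear {ffun I -> F^o} -> {ffun J -> F^o}} :=
  HB.pack g (GRing.isLinear.Build _ _ _ _ g g_lin).
exists (vpick (lker (linfun gL))) => [j|].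
  have := memv_pick (lker (linfun gL)); rewrite memv_ker lfunE => /eqP.
  by move=> /ffunP/(_ j); rewrite !ffunE.
rewrite vpick0; apply: contraTneq ltJI => ker0; rewrite -leqNgt.
have := limg_ker_dim (linfun gL) fullv.
rewrite ker0 capv0 dimv0 add0n => dimE.
have := dimvS (subvf (linfun gL @: fullv)); rewrite dimE !dimvf /dim /=.
by rewrite !muln1.
Qed.

(** In a commuting square of group elements, three of whose sides agree with the
values at the corners, so does the fourth.  As a count, this is the condition
at each crossing in [flow_supported]. *)
Lemma count_square_defects (G : finGroupType) (a b c d n f i t : G) :
  (i * f = n * t)%g ->
  (((a * n)%g != b) + ((c * f)%g != d)
    + ((a * i)%g != c) + ((b * t)%g != d) != 1)%N.
Proof.
move=> flat.
have [<-|nb] := eqVneq (a * n)%g b; have [<-|ic] := eqVneq (a * i)%g c => /=.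
- by rewrite -!mulgA flat; case: (_ == d).
- have [fd|_] := eqVneq (c * f)%g d; have [td|_] := eqVneq (a * n * t)%g d => //.
  by move: ic; rewrite -(inj_eq (mulIg f)) fd -mulgA flat mulgA td eqxx.
- have [fd|_] := eqVneq (a * i * f)%g d; have [td|_] := eqVneq (b * t)%g d => //.
  by move: nb; rewrite -(inj_eq (mulIg t)) td -mulgA -flat mulgA fd eqxx.
- by case: (_ == d); case: (_ == d).
Qed.

(** * Diagrams as 4-valent graphs on the sphere *)

Section Diagram.
Variable D : diagram.

Lemma region_constant (T : Type) (f : region D -> T) :
  (forall e, f (right_region e) = f (left_region e)) ->
  forall r s, f r = f s.
Proof.
move=> f_edge r s; have [/(_ r s)/connectP[q path_q ->] _] := diagram_spherical D.
elim: q r path_q => //= t q IHq r /andP[/existsP[e rt] /IHq <-].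
by case/orP: rt => /eqP[-> ->]; rewrite f_edge.
Qed.

(** The two edges of the over-strand at [c], named by their position relative to
[r_ini c]: [over_near c] bounds that region.  Crossing first [under_ini] and
then [over_far], or first [over_near] and then [under_ter], are the two ways
from [r_ini c] to the opposite corner, whatever the sign of [c]. *)
Definition over_near (c : crossing D) :=
  if positive c then over_out c else over_in c.
Definition over_far (c : crossing D) :=
  if positive c then over_in c else over_out c.

Lemma corner_regions (c : crossing D) :
  [/\ right_region (over_near c) = right_region (under_ini c),
      left_region (over_near c) = right_region (under_ter c),
      right_region (over_far c) = left_region (under_ini c)
    & left_region (over_far c) = left_region (under_ter c)].
Proof.
have cw := @diagram_corners D c.
move: (cw true true) (cw true false) (cw false true) (cw false false).
rewrite /over_near /over_far /corner_over /corner_under /side_region /=.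
by case: (positive c) => /= *; split.
Qed.

Lemma sum_incoming_outgoing (V : nmodType) (z : edge D -> V) :
  \sum_(s : crossing D * bool) z (incoming s) =
  \sum_(s : crossing D * bool) z (outgoing s).
Proof.
have [in_inj out_inj in_out] := diagram_strands D.
rewrite -(big_map (@incoming D) predT z) -[RHS](big_map (@outgoing D) predT z).
have uniq_img (h : crossing D * bool -> edge D) :
    injective h -> uniq (map h (index_enum _)).
  by move=> h_inj; rewrite map_inj_uniq ?index_enum_uniq.
have mem_img (h : crossing D * bool -> edge D) :
    map h (index_enum _) =i codom h.
  move=> e; apply/mapP/codomP => [[s _ ->]|[s ->]]; first by exists s.
  by exists s; rewrite ?mem_index_enum.
apply: perm_big; apply: uniq_perm; try exact: uniq_img.
by move=> e; rewrite !mem_img.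
Qed.

Lemma sum_ends (V : nmodType) (F : crossing D * bool -> V) :
  \sum_s F s = \sum_c (F (c, true) + F (c, false)).
Proof.
rewrite (eq_bigr (fun s => F (s.1, s.2))) => [|[c b] _] //.
rewrite -(pair_bigA _ (fun c b => F (c, b))) /=.
by apply: eq_bigr => c _; rewrite big_bool.
Qed.

(** Flows are the 1-cycles of the 4-valent graph, and also the 1-cocycles of the
dual square complex, with a vertex per region and a square per crossing. *)
Definition flow (z : edge D -> rat) := forall c,
  z (over_in c) + z (under_in c) = z (over_out c) + z (under_out c).

Lemma flow_ini_ter z : (forall c, z (under_ini c) + z (over_far c) =
   z (over_near c) + z (under_ter c)) -> flow z.
Proof.
move=> zP c; have := zP c; rewrite /under_ini /under_ter /over_near /over_far.
by case: (positive c); lra.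
Qed.

Lemma potential_flow (f : region D -> rat) :
  flow (fun e => f (left_region e) - f (right_region e)).
Proof.
by apply: flow_ini_ter => c; have [-> -> -> ->] := corner_regions c; ring.
Qed.

(** A graph without vertices of degree 1 has at least as many edges as vertices,
while the conservation laws at the vertices satisfy a linear relation: their
sum is zero, since each open edge leaves one crossing and arrives at one.  So
conservation has a nonzero solution on [U]. *)
Lemma flow_supported (U : {set edge D}) (e0 : edge D) : e0 \in U ->
  (forall c, (over_in c \in U) + (over_out c \in U)
           + (under_in c \in U) + (under_out c \in U) != 1)%N ->
  exists z, [/\ flow z, forall e, e \notin U -> z e = 0 & exists e, z e != 0].
Proof.
move=> Ue0 degN1.
have [in_inj out_inj in_out] := diagram_strands D.
pose deg c := ((over_in c \in U) + (over_out c \in U)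
           + (under_in c \in U) + (under_out c \in U))%N.
(* The law at [c0] follows from the others and is left out of the system. *)
pose c0 := [pick c | (deg c > 0)%N].
pose I : finType := {e | e \in U}.
pose V := [set c | (deg c > 0)%N].
pose W := [set c in V | Some c != c0].
pose J : finType := {c | c \in W}.
pose ext (x : {ffun I -> rat^o}) (e : edge D) : rat^o :=
  \sum_(y : I | val y == e) x y.
pose f (j : J) x := let c := val j in
  ext x (over_in c) + ext x (under_in c)
    - ext x (over_out c) - ext x (under_out c).
have ext_lin e : linear (ext^~ e).
  move=> a x y; rewrite /ext scaler_sumr -big_split /=.
  by apply: eq_bigr => i _; rewrite !ffunE.
have f_lin j : linear (f j).
  by move=> a x y; rewrite /f !ext_lin /GRing.scale /=; ring.
have ltJI : (#|J| < #|I|)%N.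
  have card_sub_set (T : finType) (A : {set T}) : #|{: {x | x \in A}}| = #|A|.
    by rewrite card_sig; apply: eq_card.
  rewrite !card_sub_set.
  have leU (h : crossing D * bool -> edge D) :
      injective h -> (\sum_(s : crossing D * bool) (h s \in U) <= #|U|)%N.
    move=> h_inj; rewrite -big_mkcond sum1dep_card.
    rewrite -(card_imset _ h_inj); apply/subset_leq_card/subsetP => e.
    by case/imsetP => s; rewrite inE => Us ->.
  (* The sum of the degrees counts each open edge of [U] twice. *)
  have le_deg : (\sum_c deg c <= #|U| + #|U|)%N.
    apply: leq_trans (leq_add (leU _ in_inj) (leU _ out_inj)).
    rewrite !sum_ends -big_split leq_sum // => c _.
    by rewrite /deg /incoming /outgoing /=; lia.
  have ge_deg : (#|V| * 2 <= \sum_c deg c)%N.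
    rewrite -sum_nat_const big_mkcond leq_sum // => c _; rewrite inE.
    by have := degN1 c; rewrite -/(deg c); case: (deg c) => [|[]].
  rewrite /W /c0; case: pickP => [c deg_c|no_deg].
    have := cardsD1 c V; rewrite inE deg_c /=.
    have -> : [set c1 in V | Some c1 != Some c] = V :\ c.
      by apply/setP => c1; rewrite !inE andbC.
    by lia.
  rewrite [X in (X < _)%N]eq_card0 => [|c]; first by apply/card_gt0P; exists e0.
  by rewrite !inE no_deg.
have [x fx0 xN0] := linear_system_solution f_lin ltJI.
have ext0 e : e \notin U -> ext x e = 0.
  move=> Ue; rewrite /ext big1 // => y /eqP ye.
  by rewrite -ye (valP y) in Ue.
exists (ext x); split.
- have cons c : Some c != c0 ->
      ext x (over_in c) + ext x (under_in c)
        - ext x (over_out c) - ext x (under_out c) = 0.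
    move=> c_c0; have [deg0|deg_c] := posnP (deg c); last first.
      have Jc : c \in W by rewrite !inE deg_c.
      exact: fx0 (exist _ c Jc).
    move: deg0; rewrite /deg.
    by do !case: (boolP (_ \in U)) => [//|/ext0->]; rewrite ?addr0 ?subr0.
  move=> c; apply/eqP; rewrite -subr_eq0 opprD addrA; apply/eqP.
  have [c_c0|/cons//] := eqVneq (Some c) c0.
  have := sum_incoming_outgoing (ext x).
  rewrite !sum_ends => /eqP.
  rewrite -subr_eq0 -sumrB (bigD1 c) //= big1 => [|c1 c1c].
    rewrite addr0 opprD addrA; exact/eqP.
  by rewrite opprD addrA cons // -c_c0; apply: contraNneq c1c => -[->].
- exact: ext0.
- have [y xy|x0] := pickP (fun y => x y != 0).
    by exists (val y); rewrite /ext (big_pred1 y) // => i; rewrite (inj_eq val_inj).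
  by case/eqP: xN0; apply/ffunP => y; rewrite ffunE; apply/eqP/negbFE/x0.
Qed.

Lemma card_roots_side_link :
  #|fingraph.roots (@side_link D)| = (\sum_(r : region D) boundary_circles r)%N.
Proof.
rewrite -sum1_card (partition_big (@side_region D) predT) //=.
apply: eq_bigr => r _; rewrite /boundary_circles /n_comp_mem.
by rewrite sum1_card; apply: eq_card => s; rewrite !inE.
Qed.

Lemma side_link_sym : connect_sym (@side_link D).
Proof.
apply: sym_connect_sym => s t; apply/existsP/existsP => -[c] /existsP[h]/existsP[l].
  by rewrite orbC => H; exists c; apply/existsP; exists h; apply/existsP; exists l.
by rewrite orbC => H; exists c; apply/existsP; exists h; apply/existsP; exists l.
Qed.

Lemma side_constant (T : Type) (q : side D -> T) :
  (forall c h l, q (corner_over c h l) = q (corner_under c h l)) ->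
  forall s, q (fingraph.root (@side_link D) s) = q s.
Proof.
move=> qc s; have /connectP[p path_p ->] := connect_root (@side_link D) s.
elim: p s path_p => //= t p IHp s /andP[/existsP[c /existsP[h /existsP[l]]]].
move=> st /IHp->.
by case/orP: st => /eqP[-> ->]; rewrite qc.
Qed.

Lemma euler_characteristic : (#|crossing D| + #|region D| + #|region D| =
  #|@open_edge D| + \sum_(r : region D) boundary_circles r + 2)%N.
Proof.
have [_] := diagram_spherical D.
have -> : \sum_(r : region D) (2 - (boundary_circles r)%:Z) =
    #|region D|%:Z * 2%:Z - (\sum_(r : region D) boundary_circles r)%N%:Z.
  rewrite sumrB sumr_const (big_morph Posz PoszD (erefl _)); congr (_ - _).
  by rewrite -(mulr_natl 2%:Z) natz.
by lia.
Qed.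

(** On an open edge, the value of [w] at its head minus that at its tail; zero on
a closed edge. *)
Definition strand_coboundary (w : crossing D -> rat) (e : edge D) : rat :=
  \sum_(s | incoming s == e) w s.1 - \sum_(s | outgoing s == e) w s.1.

Lemma strand_coboundary_orthogonal w z :
  flow z -> \sum_e strand_coboundary w e * z e = 0.
Proof.
move=> zP.
have expand (h : crossing D * bool -> edge D) :
    \sum_e (\sum_(s | h s == e) w s.1) * z e =
    \sum_c w c * (z (h (c, true)) + z (h (c, false))).
  under eq_bigr do rewrite mulr_suml.
  rewrite (exchange_big_dep predT) //=.
  rewrite (eq_bigr (fun s => w s.1 * z (h s))) => [|s _]; last first.
    by rewrite (big_pred1 (h s)) // => e; rewrite eq_sym.
  rewrite sum_ends.
  by apply: eq_bigr => c _; rewrite mulrDr.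
rewrite (eq_bigr _ (fun e _ => mulrBl _ _ _)) sumrB !expand -sumrB big1 // => c _.
by rewrite -mulrBr zP subrr mulr0.
Qed.

(** The first rational cohomology of the sphere vanishes.  If [z] were not exact,
the linear system [F] below would have only the zero solution.  Its unknowns
are a function [w] of the crossings, a function [y] of the closed edges, two
functions [f] and [g] of the regions, and a scalar [t].
- The equation at an edge splits into two, because coboundaries are orthogonal
  to flows: [w] takes equal values at the ends of each edge, and the flow [u],
  the sum of [t z] and the difference of [g] across the edge, is zero.  As [z]
  is not exact, [t] is zero and [g] is constant.
- By [w] and [y], each component of the diagram gets a number [k].  The equation
  at a boundary circle says that [f] in its region and [k] on its component add
  up to zero, so that [f] is constant as well.
- The last two equations set the constants [f] and [g] to zero.
By the Euler characteristic, there is one unknown more than there are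
equations, so that this system has a nonzero solution. *)
Lemma flow_exact (z : edge D -> rat) : flow z ->
  exists f : region D -> rat,
    forall e, z e = f (left_region e) - f (right_region e).
Proof.
move=> zP; have [in_inj out_inj in_out] := diagram_strands D.
have [e0 _|no_edge] := pickP (edge D); last first.
  by exists (fun=> 0) => e; have := no_edge e.
pose r0 := left_region e0.
pose closed_edge : finType := {e | ~~ @open_edge D e}.
pose I : finType := (crossing D + closed_edge + (region D + region D) + unit)%type.
(* Boundary circles are represented by the chosen roots of their sides. *)
pose circle : finType := {s | fingraph.roots (@side_link D) s}.
pose J : finType := (edge D + circle + bool)%type.
pose w (x : {ffun I -> rat^o}) c : rat^o := x (inl (inl (inl c))).
pose y (x : {ffun I -> rat^o}) c : rat^o := x (inl (inl (inr c))).
pose f (x : {ffun I -> rat^o}) r : rat^o := x (inl (inr (inl r))).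
pose g (x : {ffun I -> rat^o}) r : rat^o := x (inl (inr (inr r))).
pose t (x : {ffun I -> rat^o}) : rat^o := x (inr tt).
pose k x e : rat^o := \sum_(s | incoming s == e) w x s.1 +
  \sum_(e1 : closed_edge | val e1 == e) y x e1.
pose u x e : rat^o := g x (left_region e) - g x (right_region e) + t x * z e.
pose F (j : J) x : rat^o := match j with
  | inl (inl e) => strand_coboundary (w x) e + u x e
  | inl (inr s) => f x (side_region (val s)) + k x (val s).1
  | inr b => if b then f x r0 else g x r0
  end.
have F_lin j : linear (F j).
  move=> a x1 x2; pose x := a *: x1 + x2.
  have xE i : x i = a * x1 i + x2 i by rewrite !ffunE.
  have sumL (T : finType) (P : pred T) (h : T -> I) :
      \sum_(i | P i) x (h i) =
      a * \sum_(i | P i) x1 (h i) + \sum_(i | P i) x2 (h i).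
    by rewrite mulr_sumr -big_split; apply: eq_bigr => i _; exact: xE.
  rewrite -/x /GRing.scale /=; case: j => [[e|s]|b] /=.
  - rewrite /strand_coboundary /u /g /t !xE.
    by rewrite !(sumL _ _ (fun s => inl (inl (inl s.1)))); ring.
  - rewrite /f /k xE (sumL _ _ (fun s => inl (inl (inl s.1)))).
    by rewrite (sumL _ _ (fun e => inl (inl (inr e)))); ring.
  - by case: b; exact: xE.
have ltJI : (#|J| < #|I|)%N.
  rewrite !card_sum card_bool card_unit.
  have -> : #|circle| = #|fingraph.roots (@side_link D)|.
    by rewrite card_sig; apply: eq_card.
  have -> : #|edge D| = (#|@open_edge D| + #|closed_edge|)%N.
    by rewrite card_sig -(cardC (@open_edge D)); congr addn; apply: eq_card.
  by have := euler_characteristic; rewrite card_roots_side_link; lia.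
have [x Fx0 xN0] := linear_system_solution F_lin ltJI.
have u_flow : flow (u x).
  move=> c; rewrite /u addrACA [RHS]addrACA -!mulrDr zP.
  by congr (_ + _); exact: (potential_flow (g x)).
(* The coboundary of [w] is minus a flow, hence orthogonal to itself. *)
have coboundary0 e : strand_coboundary (w x) e = 0.
  have sq0 : \sum_e1 strand_coboundary (w x) e1 ^+ 2 = 0.
    transitivity (- \sum_e1 strand_coboundary (w x) e1 * u x e1); last first.
      by rewrite strand_coboundary_orthogonal ?oppr0.
    rewrite -sumrN; apply: eq_bigr => e1 _; have /= := Fx0 (inl (inl e1)).
    move/eqP; rewrite addr_eq0 => /eqP b_u.
    by rewrite expr2 [X in _ * X]b_u mulrN.
  have /psumr_eq0P/(_ sq0 e erefl)/eqP :
      forall e1, predT e1 -> 0 <= strand_coboundary (w x) e1 ^+ 2.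
    by move=> e1 _; exact: sqr_ge0.
  by rewrite sqrf_eq0 => /eqP.
have u0 e : u x e = 0 by have := Fx0 (inl (inl e)); rewrite /= coboundary0 add0r.
(* For a nonzero [t], the vanishing of [u] exhibits [z] as exact. *)
have [tx0|txN0] := eqVneq (t x) 0; last first.
  exists (fun r => - g x r / t x) => e; have := u0 e; rewrite /u.
  move=> ue0; apply: (mulfI txN0).
  have -> : t x * (- g x (left_region e) / t x - - g x (right_region e) / t x) =
            g x (right_region e) - g x (left_region e) by field.
  by lra.
case/eqP: xN0.
have gx0 r : g x r = 0.
  rewrite (@region_constant _ (g x) _ _ r0); first exact: (Fx0 (inr false)).
  move=> e; have := u0 e; rewrite /u tx0; lra.
have k_in s : k x (incoming s) = w x s.1.
  rewrite /k (big_pred1 s) => [|s1]; last by rewrite (inj_eq in_inj).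
  rewrite big1 ?addr0 // => e1 /eqP e1s; have := valP e1.
  by rewrite e1s /open_edge /= -in_out codom_f.
have k_out s : k x (outgoing s) = w x s.1.
  rewrite /k; have /eqP := coboundary0 (outgoing s); rewrite subr_eq0 => /eqP->.
  rewrite (big_pred1 s) => [|s1]; last by rewrite (inj_eq out_inj).
  rewrite big1 ?addr0 // => e1 /eqP e1s; have := valP e1.
  by rewrite e1s /open_edge /= codom_f.
have fk0 s : f x (side_region s) + k x s.1 = 0.
  rewrite -(@side_constant _ (fun s => f x (side_region s) + k x s.1)); last first.
    move=> c h l; rewrite (@diagram_corners D) /corner_over /corner_under.
    congr (_ + _).
    have kE b :
        (k x (incoming (c, b)) = w x c) * (k x (outgoing (c, b)) = w x c).
      by split; [exact: k_in | exact: k_out].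
    move: (kE true) (kE false).
    rewrite /under_ini /under_ter /incoming /outgoing /=.
    by move=> kt kf; case: h l (positive c) => [] [] [] /=; rewrite ?kt ?kf.
  have circ_s : fingraph.roots (@side_link D) (fingraph.root (@side_link D) s).
    exact: roots_root side_link_sym _.
  exact: Fx0 (inl (inr (Sub _ circ_s : circle))).
have fx0 r : f x r = 0.
  rewrite (@region_constant _ (f x) _ _ r0); first exact: (Fx0 (inr true)).
  move=> e; have := fk0 (e, true); have := fk0 (e, false); rewrite /side_region /=.
  by lra.
have kx0 e : k x e = 0.
  by have := fk0 (e, true); rewrite fx0 add0r.
apply/ffunP => -[[[c|e]|[r|r]]|[]]; rewrite ffunE //.
- by have := k_in (c, true); rewrite kx0.
- have := kx0 (val e); rewrite /k big_pred0 => [|s]; last first.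
    apply: contraNF (valP e) => /eqP <-.
    by rewrite /open_edge /= -in_out codom_f.
  by rewrite add0r (big_pred1 e) // => e1; rewrite (inj_eq val_inj).
- exact: fx0.
- exact: gx0.
Qed.

(** The sphere is simply connected.  This is noncommutative, so it does not follow
from [flow_exact] by linear algebra; the labelling [h] that makes the most edges
trivial reduces it to the flows supported on the other edges. *)
Lemma flat_labelling_potential (G : finGroupType) (g : edge D -> G) :
  (forall c, (g (under_ini c) * g (over_far c) =
              g (over_near c) * g (under_ter c))%g) ->
  exists h : region D -> G,
    forall e, (h (right_region e) * g e)%g = h (left_region e).
Proof.
move=> g_flat.
pose N (h : {ffun region D -> G}) :=
  [set e | (h (right_region e) * g e)%g == h (left_region e)].
case: (arg_maxnP (fun h => #|N h|) (erefl (xpredT [ffun=> 1%g]))) => h _ h_max.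
(* A function [f] that takes different values across a nontrivial edge [e] only
   gives a better labelling: multiply [h] on a level set of [f] by the constant
   [a] that makes [e] trivial; this preserves the trivial edges, which join
   regions of the same level. *)
have N_connects (f : region D -> rat) :
    (forall e, e \in N h -> f (right_region e) = f (left_region e)) ->
    forall e, f (right_region e) = f (left_region e).
  move=> fN e; apply/eqP/negPn/negP => fe.
  pose a := (h (right_region e) * g e * (h (left_region e))^-1)%g.
  pose h' := [ffun r => if f r == f (left_region e) then (a * h r)%g else h r].
  have : N h \proper N h'.
    apply/properP; split.
      apply/subsetP => e1 Ne1; move: (Ne1); rewrite !inE !ffunE (fN _ Ne1).
      by case: (f _ == f _) => //; rewrite -mulgA (inj_eq (mulgI a)).
    exists e; last by apply: contra fe => /fN/eqP.
    by rewrite inE !ffunE eqxx (negPf fe) /a mulgKV.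
  by move/proper_card; rewrite ltnNge => /negP; apply; exact: (h_max h').
have [U0|[e0 Ue0]] := set_0Vmem (~: N h).
  exists h => e; apply/eqP; have := in_setT e; rewrite -setC0 -U0 setCK.
  by rewrite inE.
have degN1 c : (((over_in c \in ~: N h) + (over_out c \in ~: N h)
           + (under_in c \in ~: N h) + (under_out c \in ~: N h)) != 1)%N.
  have -> : ((over_in c \in ~: N h) + (over_out c \in ~: N h)
           + (under_in c \in ~: N h) + (under_out c \in ~: N h) =
     (over_near c \in ~: N h) + (over_far c \in ~: N h)
           + (under_ini c \in ~: N h) + (under_ter c \in ~: N h))%N.
    by rewrite /over_near /over_far /under_ini /under_ter; case: (positive c); lia.
  have := g_flat c; have [c1 c2 c3 c4] := corner_regions c.
  rewrite !inE c1 c2 c3 c4 => flat.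
  exact: count_square_defects.
have [z [z_flow z_U [e ze]]] := flow_supported Ue0 degN1.
have [f zE] := flow_exact z_flow.
suff f_edge : f (right_region e) = f (left_region e).
  by case/eqP: ze; rewrite zE f_edge subrr.
apply: N_connects => e1 Ne1; apply/esym/eqP; rewrite -subr_eq0 -zE; apply/eqP.
by apply: z_U; rewrite inE negbK.
Qed.

End Diagram.

(** * The cocycle condition on quadruples *)

Section LinearExtension.
Variables (K : choiceType) (V : zmodType) (f : K -> V).

Lemma linear_ext_supp (c : {malg int[K]}) (d : {fset K}) :
  (msupp c `<=` d)%fset -> linear_ext f c = \sum_(x <- d) f x *~ c@_x.
Proof.
move=> cd; rewrite /linear_ext (big_fset_incl _ cd) // => x _ xc.
by rewrite mcoeff_outdom // mulr0z.
Qed.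

Lemma linear_ext_is_additive : additive (linear_ext f).
Proof.
move=> c1 c2; pose d := (msupp c1 `|` msupp c2)%fset.
rewrite (@linear_ext_supp (c1 - c2) d) ?msuppB_le //.
rewrite (@linear_ext_supp c1 d) ?fsubsetUl //.
rewrite (@linear_ext_supp c2 d) ?fsubsetUr //.
by rewrite -sumrB; apply: eq_bigr => x _; rewrite mcoeffB mulrzBr.
Qed.

HB.instance Definition _ := GRing.isAdditive.Build {malg int[K]} V (linear_ext f)
  linear_ext_is_additive.

Lemma linear_extU x : linear_ext f << x >> = f x.
Proof. by rewrite /linear_ext msuppU /= big_seq_fset1 mcoeffUU. Qed.

Lemma linear_ext_sign n c :
  linear_ext f ((-1) ^+ n *: c) = linear_ext f c *~ (-1) ^+ n.
Proof.
rewrite -signr_odd; case: (odd n); rewrite ?expr1 ?expr0 ?scale1r //.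
by rewrite scaleN1r raddfN mulrNz.
Qed.

End LinearExtension.

(** The value of [phi] on the boundary of (r, x, y, z), in the order that suits a
crossing: on the right are the contributions of the over-arc [z] and of the
under-arc [y], each a difference between the two sides of the other strand. *)
Lemma cocycle_identity (X : quandleType) (A : pzRingType) (phi : 3.-tuple X -> A)
    (r x y z : X) : quandle_3cocycle phi ->
  phi [tuple r ◁ x; y; z] - phi [tuple r; y; z] =
  (phi [tuple r ◁ y; x ◁ y; z] - phi [tuple r; x; z])
  - (phi [tuple r ◁ z; x ◁ z; y ◁ z] - phi [tuple r; x; y]).
Proof.
case=> _ _ /(_ << [tuple r; x; y; z] >>).
rewrite /boundary [X in linear_ext phi X]linear_extU raddf_sum /=.
rewrite (eq_bigr (fun i : 'I_4 =>
  (phi (face_act i [tuple r; x; y; z]) - phi (face i [tuple r; x; y; z]))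
    *~ (-1) ^+ (3 - i))) => [|i _]; last first.
  by rewrite linear_ext_sign raddfB; congr (_ *~ _); rewrite /= !linear_extU.
rewrite !big_ord_recl big_ord0.
set t := [tuple r; x; y; z].
pose i1 : 'I_4 := lift ord0 ord0; pose i2 : 'I_4 := lift ord0 (lift ord0 ord0).
pose i3 : 'I_4 := lift ord0 (lift ord0 (lift ord0 ord0)).
have face0 : face_act ord0 t = face ord0 t.
  by apply: eq_from_tnth => j; rewrite !tnth_mktuple.
have tupleE (u : 3.-tuple X) a b c : tnth u (@Ordinal 3 0 isT) = a ->
    tnth u (@Ordinal 3 1 isT) = b -> tnth u (@Ordinal 3 2 isT) = c ->
    u = [tuple a; b; c].
  move=> ua ub uc; apply: eq_from_tnth => -[[|[|[|//]]] lt_j].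
  - by rewrite -[RHS]ua; congr tnth; apply: val_inj.
  - by rewrite -[RHS]ub; congr tnth; apply: val_inj.
  - by rewrite -[RHS]uc; congr tnth; apply: val_inj.
have -> : face_act i1 t = [tuple r ◁ x; y; z].
  by apply: tupleE; rewrite tnth_mktuple.
have -> : face i1 t = [tuple r; y; z] by apply: tupleE; rewrite tnth_mktuple.
have -> : face_act i2 t = [tuple r ◁ y; x ◁ y; z].
  by apply: tupleE; rewrite tnth_mktuple.
have -> : face i2 t = [tuple r; x; z] by apply: tupleE; rewrite tnth_mktuple.
have -> : face_act i3 t = [tuple r ◁ z; x ◁ z; y ◁ z].
  by apply: tupleE; rewrite tnth_mktuple.
have -> : face i3 t = [tuple r; x; y] by apply: tupleE; rewrite tnth_mktuple.
have -> : (-1) ^+ (3 - i1) = 1 :> int by [].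
have -> : (-1) ^+ (3 - i2) = -1 :> int by [].
have -> : (-1) ^+ (3 - i3) = 1 :> int by [].
rewrite face0 subrr mul0rz add0r addr0 mulrN1z !mulr1z.
by move/eqP; rewrite addr_eq0 opprD opprK => /eqP.
Qed.

(** * Shadow colourings with given arc colours *)

Section Colourings.
Variables (D : diagram) (X : finQuandleType).

Lemma qop_inj (b : X) : injective (fun a : X => a ◁ b).
Proof. by move=> a1 a2 E; rewrite -(qopK a1 b) E qopK. Qed.

Lemma arc_of_over_in (c : crossing D) : arc_of (over_in c) = o_arc c.
Proof.
have sym : connect_sym (@strand_link D).
  apply: sym_connect_sym => e f.
  by apply/existsP/existsP => -[d H]; exists d; rewrite orbC.
apply: val_inj; apply/setP => e; rewrite !inE.
apply: (same_connect sym); apply: connect1.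
by apply/existsP; exists c; rewrite eqxx.
Qed.

Lemma arc_of_over_near (c : crossing D) : arc_of (over_near c) = o_arc c.
Proof. by rewrite /over_near; case: (positive c); rewrite ?arc_of_over_in. Qed.

Lemma arc_of_over_far (c : crossing D) : arc_of (over_far c) = o_arc c.
Proof. by rewrite /over_far; case: (positive c); rewrite ?arc_of_over_in. Qed.

Lemma r_ini_near (c : crossing D) : r_ini c = right_region (over_near c).
Proof.
by rewrite /r_ini /over_near /corner_over /side_region /=; case: (positive c).
Qed.

Definition arc_colouring (k : {ffun Defs.arc D -> X}) :=
  [forall c : crossing D, k (u_ini c) ◁ k (o_arc c) == k (u_ter c)].

Definition region_colouring
    (k : {ffun Defs.arc D -> X}) (s : {ffun region D -> X}) :=
  [forall e : edge D, s (right_region e) ◁ k (arc_of e) == s (left_region e)].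

Lemma region_colouring_unique k s1 s2 r0 :
  region_colouring k s1 -> region_colouring k s2 -> s1 r0 = s2 r0 -> s1 = s2.
Proof.
move=> /forallP s1P /forallP s2P s12; apply/ffunP => r; apply/eqP.
suff -> : (s1 r == s2 r) = (s1 r0 == s2 r0) by apply/eqP.
apply: (@region_constant D _ (fun r => s1 r == s2 r)) => e.
by rewrite -(eqP (s1P e)) -(eqP (s2P e)) (inj_eq (@qop_inj (k (arc_of e)))).
Qed.

(** The permutations by which the edges act agree around a crossing by
self-distributivity, so a potential [h] for them exists; applied to the colour
[a] transported to [r0], it colours all the regions. *)
Lemma region_colouring_exists k r0 a : arc_colouring k ->
  exists2 s, region_colouring k s & s r0 = a.
Proof.
move=> /forallP kP; pose g (e : edge D) := perm (@qop_inj (k (arc_of e))).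
have [|h hP] := @flat_labelling_potential D _ g.
  move=> c; apply/permP => x; rewrite !permM !permE.
  by rewrite arc_of_over_near arc_of_over_far -(eqP (kP c)) qop_distr.
exists [ffun r => h r ((h r0)^-1%g a)]; last by rewrite ffunE permKV.
apply/forallP => e; rewrite !ffunE -hP permM.
by rewrite [X in _ == X]permE.
Qed.

Variables (A : pzRingType) (phi : 3.-tuple X -> A).

Definition act_colouring (s x : {ffun region D -> X}) := [ffun r => s r ◁ x r].

Lemma card_region_colouring k (r0 : region D) : arc_colouring k ->
  #|[pred s | region_colouring k s]| = #|X|.
Proof.
move=> kP; pose colour_r0 (s : {ffun region D -> X}) := s r0.
rewrite -(@card_in_image _ _ colour_r0) => [|s1 s2 s1P s2P].
  apply: eq_card => a; rewrite [RHS]inE; apply/imageP.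
  by have [s sP <-] := region_colouring_exists r0 a kP; exists s.
by move: s1P s2P; rewrite !inE; exact: region_colouring_unique.
Qed.

Lemma based_region_colouring p k s : region_colouring k s ->
  based_at p (k, s) = (s (right_region p) == k (arc_of p)).
Proof.
move=> /forallP/(_ p)/eqP sp; rewrite /based_at /= -sp.
by case: eqP => // ->; rewrite qop_idem eqxx.
Qed.

Lemma region_colouring_act k s x :
  region_colouring k s -> region_colouring k x ->
  region_colouring k (act_colouring s x).
Proof.
move=> /forallP sP /forallP xP; apply/forallP => e; rewrite !ffunE.
by rewrite -(eqP (sP e)) -(eqP (xP e)) qop_distr.
Qed.

(** Pulling a circle under the whole diagram: [F e] is the weight of the crossing
where the moving circle passes under the edge [e] from its right side.  The
cocycle condition at a crossing of the diagram compares the four edges there. *)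
Lemma whole_weight_act k s x : quandle_3cocycle phi -> arc_colouring k ->
  region_colouring k s -> region_colouring k x ->
  whole_weight phi (k, act_colouring s x) = whole_weight phi (k, s).
Proof.
move=> phi_cocycle /forallP kP /forallP sP /forallP xP.
pose F e := phi [tuple s (right_region e); x (right_region e); k (arc_of e)].
apply/eqP; rewrite -subr_eq0 -sumrB.
rewrite (eq_bigr (fun c => (F (over_in c) + F (under_in c))
                           - (F (over_out c) + F (under_out c)))); last first.
  move=> c _; have [near_ini near_ter far_ini _] := corner_regions c.
  have id := cocycle_identity (s (r_ini c)) (x (r_ini c))
                              (k (u_ini c)) (k (o_arc c)) phi_cocycle.
  have Fini : F (under_ini c) = phi [tuple s (r_ini c); x (r_ini c); k (u_ini c)].
    by rewrite /F r_ini_near near_ini.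
  have Fnear : F (over_near c) = phi [tuple s (r_ini c); x (r_ini c); k (o_arc c)].
    by rewrite /F r_ini_near arc_of_over_near.
  have Ffar : F (over_far c) = phi [tuple s (r_ini c) ◁ k (u_ini c);
                                          x (r_ini c) ◁ k (u_ini c); k (o_arc c)].
    rewrite /F r_ini_near arc_of_over_far far_ini near_ini.
    by rewrite -(eqP (sP _)) -(eqP (xP _)).
  have Fter : F (under_ter c) = phi [tuple s (r_ini c) ◁ k (o_arc c);
             x (r_ini c) ◁ k (o_arc c); k (u_ini c) ◁ k (o_arc c)].
    rewrite /F r_ini_near -near_ter -(eqP (sP _)) -(eqP (xP _)) arc_of_over_near.
    by rewrite (eqP (kP c)).
  move: id; rewrite -Fini -Fnear -Ffar -Fter => {Fini Fnear Ffar Fter}.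
  rewrite /boltzmann_weight /= ffunE /over_near /over_far /under_ini /under_ter.
  case: (positive c) => id; rewrite -?opprD id.
    by rewrite opprB opprD addrACA.
  by rewrite opprB opprB addrC opprD addrACA.
rewrite sumrB subr_eq0; apply/eqP.
by have := sum_incoming_outgoing F; rewrite !sum_ends.
Qed.

(** Connectedness of X leads from the colour of [r0] under [s1] to that under [s2]
in steps of the form [a ◁ x] or [a ◀ x].  A step is made by acting with the
region colouring whose colour at [r0] is [x]; a step [a ◀ x] is undone by it. *)
Lemma whole_weight_base k s1 s2 :
  quandle_3cocycle phi -> quandle_connected X -> arc_colouring k ->
  region_colouring k s1 -> region_colouring k s2 ->
  whole_weight phi (k, s1) = whole_weight phi (k, s2).
Proof.
move=> phi_cocycle hX kP s1P s2P.
have [r0 _|no_region] := pickP (region D); last first.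
  by congr (whole_weight phi (k, _)); apply/ffunP => r; have := no_region r.
have [q] := hX (s1 r0) (s2 r0).
elim: q s1 s1P => [|[b x] q IHq] s1 s1P /= s12.
  by rewrite (region_colouring_unique s1P s2P s12).
have [y yP yx] := region_colouring_exists r0 x kP.
have [s sP s_x] := region_colouring_exists r0 (qexp (s1 r0) b x) kP.
rewrite -(IHq _ sP) ?s_x //; case: b s_x {s12} => /= s_x.
  rewrite -(whole_weight_act phi_cocycle kP s1P yP).
  congr (whole_weight phi (k, _)).
  apply: (region_colouring_unique (r0 := r0) _ sP).
    exact: region_colouring_act.
  by rewrite ffunE yx s_x.
rewrite -(whole_weight_act phi_cocycle kP sP yP); congr (whole_weight phi (k, _)).
apply: (region_colouring_unique (r0 := r0) s1P); first exact: region_colouring_act.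
by rewrite ffunE yx s_x qinvK.
Qed.

End Colourings.

Theorem theorem1p2 (X : finQuandleType) (hX : quandle_connected X)
    (A : pzRingType) (phi : 3.-tuple X -> A) (hphi : quandle_3cocycle phi)
    (D : diagram) (p : edge D) :
  shadow_invariant D phi = based_shadow_invariant phi p *+ #|X|.
Proof.
have sum_fibres (P : pred (colouring D X)) :
    \sum_(C | shadow_colouring C && P C) << whole_weight phi C >> =
    \sum_(k | arc_colouring k) \sum_(s | region_colouring k s && P (k, s))
      << whole_weight phi (k, s) >> :> {malg int[A]}.
  rewrite pair_big_dep; apply: eq_big => [[k s]|[k s] _] //=.
  by rewrite -andbA.
transitivity (\sum_(C : colouring D X | shadow_colouring C && predT C)
                 << whole_weight phi C >> : {malg int[A]}).
  by apply: eq_bigl => C; rewrite andbT.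
rewrite /based_shadow_invariant !sum_fibres -sumrMnl; apply: eq_bigr => k kP.
have [s0 s0P s0p] := region_colouring_exists (right_region p) (k (arc_of p)) kP.
rewrite [in RHS](big_pred1 s0) => [|s] /=; last first.
  apply/andP/eqP => [[sP]|->]; last by rewrite based_region_colouring // s0p.
  rewrite based_region_colouring // -s0p => /eqP.
  exact: region_colouring_unique sP s0P.
rewrite -(card_region_colouring (right_region p) kP) -sumr_const.
apply: eq_big => [s|s /andP[sP _]]; first by rewrite /= andbT inE.
by rewrite (whole_weight_base hphi hX kP sP s0P).
Qed.
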